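(* Let $n\ge 2$ be an integer and let $x,y$ be complex numbers such that no denominator below vanishes, i.e. $x\notin\{-1,\dots,-n\}$, $1+x-y\ne0$ and $y\notin\{-n,-n+1,\dots,n-1\}$. Then $$\sum_{k=0}^n(-1)^k\binom{n}{k}\frac{\binom{y+k}{k}}{\binom{y-n+k}{k}}\frac{(y-1)y}{(y+k-1)(y+k)}H_{k}(x)=\frac{(-1)^n(1+x-y+ny)}{n(n-1)(1+x-y)}\,\frac{\binom{x-y+n}{n}}{\binom{x+n}{n}\binom{y}{n}}-\frac{(-1)^n}{n(n-1)}\,\frac{1}{\binom{y}{n}}.$$
   Context: For a complex number $u$ and an integer $k\ge 0$, $\binom{u}{k}=\frac{u(u-1)\cdots(u-k+1)}{k!}$ (equal to $1$ for $k=0$). For a complex number $u$, the generalized harmonic numbers are $H_0(u)=0$ and $H_n(u)=\sum_{k=1}^n\frac{1}{u+k}$ for $n\ge1$. *)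

(* Defs.v *)
From mathcomp Require Import all_boot all_order all_algebra.
From mathcomp Require Import reals.
From mathcomp.real_closed Require Import complex.
Set Implicit Arguments.
Unset Strict Implicit.
Unset Printing Implicit Defensive.
Import Order.TTheory GRing.Theory Num.Theory.
Local Open Scope ring_scope.

(* The complex numbers are R[i] for R : realType, a Dedekind-complete
   ordered field. *)

Definition cbinom (R : realType) (u : R[i]) (k : nat) : R[i] :=
  (\prod_(0 <= i < k) (u - i%:R)) / (k`!)%:R.

Definition gharm (R : realType) (n : nat) (u : R[i]) : R[i] :=
  \sum_(1 <= k < n.+1) 1 / (u + k%:R).

(* Main.v *)
Require Import Defs.
From mathcomp Require Import all_boot all_order all_algebra.
From mathcomp Require Import reals.
From mathcomp.real_closed Require Import complex.
From mathcomp Require Import ring.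
Set Implicit Arguments.
Unset Strict Implicit.
Unset Printing Implicit Defensive.
Import Order.TTheory GRing.Theory Num.Theory.
Local Open Scope ring_scope.

(* The quotient of binomials and the rational factor combine so that the
   weight a_k of H_k(x) is (-n)_k (y-1)_k / (k! (y-n+1)_k).  Its partial sums
   S_k have a closed form (Gosper), and S_n = 0.  Hence summation by parts
   turns the left-hand side into - \sum_(k < n) S_k / (x + k + 1), where S_k is
   (-1)^k 'C(n-1, k) times a polynomial in k of degree n.  Up to a constant,
   such a sum is the partial fraction expansion in x of a rational function
   with simple poles at -1, ..., -n. *)

Definition rising (F : nzRingType) (z : F) (n : nat) : F :=
  \prod_(0 <= i < n) (z + i%:R).

Section Rising.
Variable F : comNzRingType.
Implicit Types w z : F.

Lemma rising0 z : rising z 0 = 1.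
Proof. by rewrite /rising big_nil. Qed.

Lemma risingS z n : rising z n.+1 = rising z n * (z + n%:R).
Proof. by rewrite /rising big_nat_recr. Qed.

Lemma rising_add z m n : rising z (m + n) = rising z m * rising (z + m%:R) n.
Proof.
elim: n => [|n IHn]; first by rewrite addn0 rising0 mulr1.
by rewrite addnS !risingS IHn natrD -mulrA addrA.
Qed.

Lemma risingSl z n : rising z n.+1 = z * rising (z + 1) n.
Proof. by rewrite -add1n rising_add risingS rising0 mul1r addr0. Qed.

(** Reversing the order of the factors pairs [1 - z - n + i] with [- (z + (n - 1 - i))]. *)
Lemma rising_opp z n : rising (1 - z - n%:R) n = (-1) ^+ n * rising z n.
Proof.
elim: n => [|n IHn]; first by rewrite !rising0 mulr1.
rewrite risingSl risingS exprS.
have -> : 1 - z - n.+1%:R + 1 = 1 - z - n%:R by rewrite -natr1; ring.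
by rewrite IHn -natr1; ring.
Qed.

Lemma falling_rising z n :
  \prod_(0 <= i < n) (z + n%:R - i%:R) = rising (z + 1) n.
Proof.
elim: n => [|n IHn]; first by rewrite rising0 big_nil.
rewrite risingS big_nat_recl //= -IHn mulrC subr0; congr (_ * _).
  by apply: eq_bigr => i _; rewrite -[n.+1%:R]natr1 -[i.+1%:R]natr1; ring.
by rewrite -natr1; ring.
Qed.

(** Pascal's rule splits each coefficient in two, and shifting the index in one half produces the
    differences of [g]. This drives the inductions for both alternating sums below. *)
Lemma alternating_sum_pascal (g : nat -> F) N :
  \sum_(0 <= k < N.+2) (-1) ^+ k * 'C(N.+1, k)%:R * g k =
  \sum_(0 <= k < N.+1) (-1) ^+ k * 'C(N, k)%:R * (g k - g k.+1).
Proof.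
transitivity (\sum_(0 <= k < N.+1) (-1) ^+ k * 'C(N, k)%:R * g k
   + \sum_(0 <= k < N.+1) (-1) ^+ k.+1 * 'C(N, k)%:R * g k.+1); last first.
  by rewrite -big_split /=; apply: eq_bigr => k _; rewrite exprS; ring.
rewrite big_nat_recl // [X in _ = X + _]big_nat_recl // -addrA.
rewrite !bin0; congr (_ + _).
have -> : \sum_(0 <= k < N) (-1) ^+ k.+1 * 'C(N, k.+1)%:R * g k.+1
    = \sum_(0 <= k < N.+1) (-1) ^+ k.+1 * 'C(N, k.+1)%:R * g k.+1.
  by rewrite [RHS]big_nat_recr //= bin_small // mulr0 mul0r addr0.
rewrite -big_split /=; apply: eq_bigr => k _.
by rewrite binS natrD; ring.
Qed.

Lemma sum_by_parts (a h : nat -> F) n :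
  \sum_(0 <= k < n.+1) a k * (\sum_(1 <= j < k.+1) h j) =
  (\sum_(0 <= k < n.+1) a k) * (\sum_(1 <= j < n.+1) h j)
  - \sum_(0 <= k < n) (\sum_(0 <= i < k.+1) a i) * h k.+1.
Proof.
elim: n => [|n IHn]; first by rewrite !big_nat1 !big_geq // subr0.
rewrite [X in _ = _ - X]big_nat_recr // [LHS]big_nat_recr //= IHn.
rewrite [\sum_(0 <= k < n.+2) a k]big_nat_recr //.
by rewrite [\sum_(1 <= j < n.+2) h j]big_nat_recr //=; ring.
Qed.

(** Up to sign this is the N-th finite difference of a monic polynomial of degree N in k, hence
    independent of [w]. *)
Lemma alternating_sum_rising w N :
  \sum_(0 <= k < N.+1) (-1) ^+ k * 'C(N, k)%:R * rising (w + k%:R) N =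
  (-1) ^+ N * N`!%:R.
Proof.
elim: N w => [|N IHN] w; first by rewrite big_nat1 rising0 !mulr1.
rewrite (alternating_sum_pascal (fun k => rising (w + k%:R) N.+1)).
rewrite (eq_bigr (fun k => - N.+1%:R *
  ((-1) ^+ k * 'C(N, k)%:R * rising (w + 1 + k%:R) N))); last first.
  move=> k _; rewrite risingSl risingS -[k.+1%:R]natr1 -[N.+1%:R]natr1.
  have -> : w + (k%:R + 1) = w + 1 + k%:R by ring.
  have -> : w + k%:R + 1 = w + 1 + k%:R by ring.
  ring.
by rewrite -mulr_sumr IHN factS natrM exprS; ring.
Qed.

End Rising.

Section RisingField.
Variable F : fieldType.
Implicit Types w z : F.

Lemma rising_neq0 z n :
  (forall i, (i < n)%N -> z + i%:R != 0) -> rising z n != 0.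
Proof.
elim: n => [|n IHn] z0; first by rewrite rising0 oner_eq0.
by rewrite risingS mulf_neq0 ?z0 // IHn // => i /ltnW; apply: z0.
Qed.

(** Partial fractions in [z]: the right-hand side has numerator of degree N over N+1 simple poles,
    so there is no polynomial part. At [z = -k] the denominator contributes [(-1)^k k! (N-k)!] to
    the residue, whence the binomial coefficient. *)
Lemma alternating_sum_rising_div w z N :
    (forall i, (i <= N)%N -> z + i%:R != 0) ->
  \sum_(0 <= k < N.+1) (-1) ^+ k * 'C(N, k)%:R
     * (rising (w + k%:R) N / (z + k%:R)) =
  N`!%:R * rising (w - z) N / rising z N.+1.
Proof.
elim: N w z => [|N IHN] w z z0.
  by rewrite big_nat1 risingS !rising0 addr0 !mul1r.
rewrite (alternating_sum_pascal
  (fun k => rising (w + k%:R) N.+1 / (z + k%:R))).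
(* Write w + k = (z + k) + (w - z) over the denominator z + k, and
   w + k + N + 1 = (z + k + 1) + (w + N - z) over z + k + 1: the polynomial
   parts cancel in the difference given by Pascal's rule. *)
have z1 i : (i <= N)%N -> z + 1 + i%:R != 0.
  by move=> iN; rewrite -addrA [1 + _]addrC natr1 z0.
transitivity ((w - z) * (\sum_(0 <= k < N.+1) (-1) ^+ k * 'C(N, k)%:R
     * (rising (w + 1 + k%:R) N / (z + k%:R)))
   - (w + N%:R - z) * (\sum_(0 <= k < N.+1) (-1) ^+ k * 'C(N, k)%:R
     * (rising (w + 1 + k%:R) N / (z + 1 + k%:R)))).
  rewrite !mulr_sumr -sumrB !big_mkord; apply: eq_bigr => -[k /= kN] _.
  have zk := z0 k (ltnW kN); have zk1 := z1 k kN.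
  rewrite risingSl risingS -[k.+1%:R]natr1.
  have -> : w + (k%:R + 1) = w + 1 + k%:R by ring.
  have -> : w + k%:R + 1 = w + 1 + k%:R by ring.
  have -> : z + (k%:R + 1) = z + 1 + k%:R by ring.
  by field; rewrite zk zk1.
rewrite !IHN //; last by move=> i /leqW; apply: z0.
have -> : w + 1 - z = w - z + 1 by ring.
have -> : w + 1 - (z + 1) = w - z by ring.
(* This makes both induction hypotheses multiples of [rising (w - z) N.+1]. *)
have eqw : (w - z) * rising (w - z + 1) N = rising (w - z) N * (w - z + N%:R).
  by rewrite -risingSl risingS.
have z00 : z != 0 by rewrite -[z]addr0 (z0 0%N).
have r0 : rising (z + 1) N != 0.
  by apply: rising_neq0 => i /ltnW; apply: z1.
have -> : (w - z) * (N`!%:R * rising (w - z + 1) N / rising z N.+1)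
        = N`!%:R * (rising (w - z) N * (w - z + N%:R)) / rising z N.+1.
  by rewrite -eqw; ring.
have zS : z + 1 + N%:R != 0 by apply: z1.
rewrite factS natrM -[N.+1%:R]natr1 [rising (w - z) N.+1]risingS.
rewrite ![rising z _]risingSl !risingS.
by field; rewrite zS r0 z00.
Qed.

End RisingField.

Section PartialSum.
Variable F : numFieldType.

(** Gosper's closed form for the weights with [n = N + 1], checked by induction on [k]. The range
    includes [k = N + 1], where ['C(N, k)] vanishes. *)
Lemma partial_sum (y : F) N k :
    (0 < N)%N -> (k <= N.+1)%N ->
    (forall i, (i <= N.+1)%N -> y + i%:R != 0) ->
    (forall i, (i <= N)%N -> y - i%:R != 0) ->
  \sum_(0 <= i < k.+1) (-1) ^+ i * 'C(N.+1, i)%:R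
     * (rising (y + 1) i / rising (y - N%:R) i)
     * ((y - 1) * y / ((y + i%:R - 1) * (y + i%:R))) =
  (-1) ^+ k * 'C(N, k)%:R * (N%:R * y - k%:R) / N%:R
     * (rising (y + 1) k / rising (y - N%:R) k) / (y + k%:R).
Proof.
move=> N0 + yD yB.
have N0' : N%:R != 0 :> F by rewrite pnatr_eq0 -lt0n.
have yn0 : y != 0 by rewrite -[y]addr0 (yD 0%N).
elim: k => [_|k IHk kN].
  have y1 : y - 1 != 0 by apply: (yB 1%N).
  rewrite big_nat1 !rising0 !bin0 addr0 subr0 divr1.
  by field; rewrite N0' yn0 y1.
rewrite big_nat_recr //= IHk; last exact: ltnW.
(* With ['C(N, k)] as the only binomial left, the induction step is a rational identity for
   [field]. *)
have binS_div : 'C(N, k.+1)%:R = (N%:R - k%:R) / (k%:R + 1) * 'C(N, k)%:R :> F.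
  have k1 : k%:R + 1 != 0 :> F by rewrite natr1 pnatr_eq0.
  apply: (mulfI k1); rewrite natr1 -natrM mul_bin_left natrM natrB //.
  by rewrite -natr1; field.
have yBk i : (i <= N)%N -> y - N%:R + i%:R != 0.
  move=> iN; have -> : y - N%:R + i%:R = y - (N - i)%:R by rewrite natrB //; ring.
  by rewrite yB // leq_subr.
have r0 : rising (y - N%:R) k != 0.
  by apply: rising_neq0 => i ik; apply: yBk; apply: leq_trans (ltnW ik) _.
have k1 : k%:R + 1 != 0 :> F by rewrite natr1 pnatr_eq0.
have yk := yD _ (ltnW kN).
have yk1 : y + (k%:R + 1) != 0 by rewrite natr1 yD.
have yNk : y - N%:R + k%:R != 0 by apply: yBk.
rewrite binS natrD binS_div !risingS exprS -natr1.
have -> : y + (k%:R + 1) - 1 = y + k%:R by ring.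
field.
rewrite N0' yk r0 yNk k1 /=.
by rewrite ?andbT addrA in yk1 *.
Qed.

End PartialSum.

Lemma cbinom_rising (R : realType) (u : R[i]) n :
  cbinom (u + n%:R) n = rising (u + 1) n / n`!%:R.
Proof. by rewrite /cbinom falling_rising. Qed.

Theorem theorem16 (R : realType) (n : nat) (x y : R[i])
  (hn : (2 <= n)%N)
  (hx : forall j : nat, (1 <= j <= n)%N -> x <> - j%:R)
  (hxy : 1 + x - y <> 0)
  (hy : forall j : int, - n%:Z <= j <= n%:Z - 1 -> y <> j%:~R) :
  \sum_(0 <= k < n.+1)
     (-1) ^+ k * 'C(n, k)%:R
     * (cbinom (y + k%:R) k / cbinom (y - n%:R + k%:R) k)
     * (((y - 1) * y) / ((y + k%:R - 1) * (y + k%:R)))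
     * gharm k x
  = ((-1) ^+ n * (1 + x - y + n%:R * y)) / (n%:R * (n%:R - 1) * (1 + x - y))
      * (cbinom (x - y + n%:R) n / (cbinom (x + n%:R) n * cbinom y n))
    - (-1) ^+ n / (n%:R * (n%:R - 1)) * (1 / cbinom y n).
Proof.
case: n hn hx hy => [//|N] N0 hx hy.
(* The integers excluded for [y] are split by sign: -n to 0 here, 0 to n-1 in [yB]. *)
have yD i : (i <= N.+1)%N -> y + i%:R != 0.
  move=> iN; apply/eqP => /(canRL (addrK _)); rewrite sub0r => yE.
  apply: (hy (- i%:Z)); last by rewrite yE rmorphN.
  by rewrite lerN2 lez_nat iN /= (@le_trans _ _ 0) // oppr_le0.
have yB i : (i <= N)%N -> y - i%:R != 0.
  move=> iN; rewrite subr_eq0; apply/eqP => yE.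
  apply: (hy i%:Z); last by rewrite yE.
  rewrite (@le_trans _ _ 0) ?oppr_le0 //=.
  by rewrite intS addrAC subrr add0r lez_nat.
have xD i : (i <= N)%N -> x + 1 + i%:R != 0.
  move=> iN; rewrite -addrA [1 + _]addrC natr1.
  by apply/eqP => /(canRL (addrK _)); rewrite sub0r; apply: hx.
pose a k : R[i] := (-1) ^+ k * 'C(N.+1, k)%:R
     * (rising (y + 1) k / rising (y - N%:R) k)
     * ((y - 1) * y / ((y + k%:R - 1) * (y + k%:R))).
have fact0 k : k`!%:R != 0 :> R[i] by rewrite pnatr_eq0 -lt0n fact_gt0.
have yBk i : (i <= N)%N -> y - N%:R + i%:R != 0.
  move=> iN; have -> : y - N%:R + i%:R = y - (N - i)%:R by rewrite natrB //; ring.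
  by rewrite yB // leq_subr.
have r0 k : (k <= N.+1)%N -> rising (y - N%:R) k != 0.
  by move=> kN; apply: rising_neq0 => i ik; apply: yBk; apply: leq_trans ik kN.
have rx0 : rising (x + 1) N.+1 != 0 by apply: rising_neq0 => i; apply: xD.
rewrite (eq_big_nat _ _ (F2 := fun k => a k * gharm k x)); last first.
  move=> k /andP[_ kN]; rewrite /a !cbinom_rising.
  have -> : y - N.+1%:R + 1 = y - N%:R by rewrite -natr1; ring.
  by rewrite invf_div [_ / _ * (_ / _)]mulrA divfK.
(* The boundary term drops out, since ['C(N, N.+1) = 0]. *)
rewrite /gharm sum_by_parts /a partial_sum // bin_small // mulr0 !mul0r sub0r.
(* Split [N y - k] as [(N y + x + 1) - (x + 1 + k)]: the first part keeps the pole, the second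
   cancels it. *)
rewrite (eq_big_nat _ _ (F2 := fun k => (N%:R * rising (y - N%:R) N.+1)^-1 *
   ((N%:R * y + (x + 1)) * ((-1) ^+ k * 'C(N, k)%:R
      * (rising (y - N%:R + k%:R) N / (x + 1 + k%:R)))
   - (-1) ^+ k * 'C(N, k)%:R * rising (y - N%:R + k%:R) N))); last first.
  move=> k /andP[_ kN].
  rewrite partial_sum //; last exact: leqW.
  have yk := yD _ (ltnW kN).
  have xk := xD _ kN.
  (* Both sides cut [rising (y - N) (N + k + 1)] into pieces. *)
  have rE : rising (y - N%:R) k * rising (y - N%:R + k%:R) N * (y + k%:R) =
      rising (y - N%:R) N.+1 * rising (y + 1) k.
    rewrite -rising_add addnC -[y + 1](_ : y - N%:R + N.+1%:R = _); last first.
      by rewrite -natr1; ring.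
    rewrite -rising_add addSn risingS natrD; congr (_ * _); ring.
  have rk := r0 k (leqW kN).
  have rN := r0 _ (leqnn N.+1).
  have N0' : N%:R != 0 :> R[i] by rewrite pnatr_eq0 -lt0n.
  have -> : rising (y + 1) k / rising (y - N%:R) k =
      rising (y - N%:R + k%:R) N * (y + k%:R) / rising (y - N%:R) N.+1.
    apply/eqP; rewrite eqr_div //; apply/eqP.
    by rewrite mulrC -rE; ring.
  rewrite -[k.+1%:R]natr1.
  have -> : x + (k%:R + 1) = x + 1 + k%:R by ring.
  by field; rewrite N0' yk xk rN.
rewrite -mulr_sumr sumrB -mulr_sumr alternating_sum_rising.
rewrite alternating_sum_rising_div //.
(* Reflection will give [rising (x - y + 2) N], which lacks the first factor [x - y + 1] of the
   numerator of [cbinom (x - y + n) n]; hence the denominator [1 + x - y] in the theorem. *)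
have -> : y - N%:R - (x + 1) = 1 - (x - y + 2) - N%:R by ring.
rewrite rising_opp !cbinom_rising.
have -> : cbinom y N.+1 = rising (y - N%:R) N.+1 / N.+1`!%:R.
  rewrite -[in LHS](subrK N.+1%:R y) cbinom_rising; congr (rising _ _ / _).
  by rewrite -natr1; ring.
rewrite [rising (x - y + 1) _]risingSl.
have -> : x - y + 1 + 1 = x - y + 2 by ring.
have rN := r0 _ (leqnn N.+1).
have N0' : N%:R != 0 :> R[i] by rewrite pnatr_eq0 -lt0n.
have N1' : N%:R + 1 != 0 :> R[i] by rewrite natr1 pnatr_eq0.
have hxy' : 1 + x - y != 0 by apply/eqP.
have fN := fact0 N.
rewrite factS natrM -[N.+1%:R]natr1 exprS.
field.
by rewrite addrK N0' N1' rN rx0 fN hxy'.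
Qed.
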